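(* For all positive real numbers $s,k$ and all $x>0$, $$\frac{J^s(x^k)}{J^k(x^s)}=\frac{\Gamma(k+1)}{\Gamma(s+1)},$$ so the ratio is independent of $x$. In particular, for the transcendental numbers $\pi$ and $e$ and all $x>0$, $$J^\pi(x^e)=\frac{\Gamma(e+1)}{\Gamma(e+\pi+1)}x^{\pi+e},\qquad J^e(x^\pi)=\frac{\Gamma(\pi+1)}{\Gamma(e+\pi+1)}x^{\pi+e},\qquad \frac{J^\pi(x^e)}{J^e(x^\pi)}=\frac{\Gamma(e+1)}{\Gamma(\pi+1)}.$$
   Context: For a real number $s>0$, the $s$-order integral operator $J^s$ is defined by $$J^s(f)(x)=\frac{1}{\Gamma(s)}\int_0^x (x-y)^{s-1}f(y)\,dy,\qquad x>0,$$ where $\Gamma$ is Euler's gamma function. $J^s(x^k)$ denotes $J^s(f)(x)$ for the function $f(x)=x^k$. *)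

(* Defs.v *)
From HB Require Import structures.
From mathcomp Require Import all_boot all_order all_algebra.
From mathcomp Require Import all_classical all_reals all_analysis.

Set Implicit Arguments.
Unset Strict Implicit.
Unset Printing Implicit Defensive.

Import Order.TTheory GRing.Theory Num.Theory.
Import numFieldNormedType.Exports.
Local Open Scope classical_set_scope.
Local Open Scope ring_scope.

(* Integrals are real-valued Lebesgue integrals ([Rintegral]).  They are taken
   over open intervals because, for an exponent s < 1, the kernels below are
   singular at an endpoint, where [powR] would give an arbitrary value. *)

(* Euler's integral of the second kind; meant for 0 < s. *)
Definition Gamma (R : realType) (s : R) : R :=
  \int[lebesgue_measure]_(t in `]0, +oo[) (t `^ (s - 1) * expR (- t)).

(* Riemann-Liouville integral of order s; meant for 0 < s and 0 < x. *)
Definition fracint (R : realType) (s : R) (f : R -> R) (x : R) : R :=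
  (Gamma s)^-1 *
  \int[lebesgue_measure]_(y in `]0, x[) ((x - y) `^ (s - 1) * f y).

(* Main.v *)
(* Up to 1/Gamma(s), J^s(x^k) is the convolution at x of the powers t^(s-1) and
   t^k truncated to the half-line. By scaling it equals x^(s+k) times its value at
   x = 1, and integrating it against e^(-x) (Tonelli) identifies that value as
   Gamma(s) Gamma(k+1) / Gamma(s+k+1). Hence
   J^s(x^k) = Gamma(k+1) / Gamma(s+k+1) x^(s+k), once Gamma is known to be finite
   and positive; the denominator and the power of x are symmetric in s and k. *)
Require Import Defs.
From mathcomp Require Import all_boot all_order all_algebra.
From mathcomp Require Import all_classical all_reals all_analysis.
From mathcomp Require Import measurable_realfun ring lra.
Import Order.TTheory GRing.Theory Num.Theory.
Import numFieldNormedType.Exports.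
Local Open Scope classical_set_scope.
Local Open Scope ring_scope.

(** * Affine substitution for Lebesgue integrals of nonnegative functions *)

Section affine_substitution.
Context {R : realType}.
Local Notation mu := (@lebesgue_measure R).

Lemma affine_preimage_itvoc (a b c d : R) : 0 < a ->
  (fun x => a * x + b) @^-1` `]c, d] = `]((c - b) / a), ((d - b) / a)]%classic.
Proof.
move=> a0; apply/seteqP; split => x /=; rewrite !in_itv/=;
  by rewrite ltr_pdivrMr// ler_pdivlMr// ltrBlDr lerBrDr [x * a]mulrC.
Qed.

(** Multiplied by [a], the pushforward of Lebesgue measure under [x => a * x + b] gives every
    half-open interval its length, so by uniqueness it is Lebesgue measure. Values in [0, +oo] are
    allowed, so the rule applies before any convergence is known. *)
Lemma ge0_integral_affine (a b : R) (f : R -> \bar R) : 0 < a ->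
  measurable_fun [set: R] f -> (forall x, 0 <= f x)%E ->
  (\int[mu]_x f x = a%:E * \int[mu]_x f (a * x + b)%R)%E.
Proof.
move=> a0 mf f0.
pose phi (x : measurableTypeR R) : measurableTypeR R := a * x + b.
have mphi : measurable_fun [set: measurableTypeR R] phi.
  by apply: measurable_funD => //; exact: measurable_funM.
unshelve epose (nu := (pushforward mu phi :
  {measure set (measurableTypeR R) -> \bar R})); first exact: mphi.
pose rho := mscale (NngNum (ltW a0)) nu.
have muE A : measurable A -> mu A = rho A.
  apply: lebesgue_measure_unique => _ [[c d]] _ <-.
  change (mu `]c, d] = a%:E * mu ((fun x => a * x + b)%R @^-1` `]c, d]))%E.
  rewrite affine_preimage_itvoc//.
  rewrite !lebesgue_measure_itv/= !lte_fin ltr_pM2r ?invr_gt0// ltrD2r.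
  case: ifP => _; last by rewrite mule0.
  by rewrite -!EFinB -EFinM; congr (_%:E); field; rewrite gt_eqF.
transitivity (\int[rho]_x f x)%E.
  by apply: eq_measure_integral => A mA _; exact: muE.
rewrite ge0_integral_mscale//=; congr (_ * _)%E.
by rewrite /nu ge0_integral_pushforward.
Qed.

End affine_substitution.

(** * Truncated powers, gamma integrals and convolutions *)

Section beta_gamma.
Context {R : realType}.
Local Notation mu := (@lebesgue_measure R).

(* Truncating powers to the half-line lets every integral below range over R. *)
Definition tpow (r t : R) : R := \1_(`]0, +oo[) t * t `^ r.

Lemma tpow_gt0E r t : 0 < t -> tpow r t = t `^ r.
Proof. by move=> t0; rewrite /tpow indicE mem_set ?mul1r//= in_itv/= t0. Qed.

Lemma tpow_le0E r t : t <= 0 -> tpow r t = 0.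
Proof.
move=> t0; rewrite /tpow indicE memNset ?mul0r//=.
by rewrite in_itv/= andbT; apply/negP; rewrite -leNgt.
Qed.

Lemma tpow_ge0 r t : 0 <= tpow r t.
Proof. by rewrite /tpow mulr_ge0// powR_ge0. Qed.

Lemma measurable_tpow r : measurable_fun [set: R] (tpow r).
Proof. by apply: measurable_funM => //; exact: measurable_indic. Qed.

Lemma tpowM r x t : 0 < x -> tpow r (x * t) = x `^ r * tpow r t.
Proof.
move=> x0; have [t0|t0] := leP t 0.
  by rewrite !tpow_le0E ?mulr0// mulr_ge0_le0// ltW.
by rewrite !tpow_gt0E ?mulr_gt0// powRM// ltW.
Qed.

Lemma measurable_gamma_integrand (r : R) :
  measurable_fun [set: R] (fun t => (tpow r t * expR (- t))%:E).
Proof.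
apply/measurable_EFinP; apply: measurable_funM; first exact: measurable_tpow.
by apply: measurableT_comp => //; exact: measurable_expR.
Qed.

Lemma gamma_integrand_ge0 (r t : R) : 0 <= tpow r t * expR (- t).
Proof. by rewrite mulr_ge0 ?tpow_ge0// expR_ge0. Qed.

(** Extended-real version of [Gamma], so that Tonelli can be used before finiteness is
    established. *)
Definition egamma (s : R) : \bar R :=
  (\int[mu]_t (tpow (s - 1) t * expR (- t))%:E)%E.

(** At [x = 1] this is Euler's beta integral B(p+1, q+1). *)
Definition econv (p q x : R) : \bar R :=
  (\int[mu]_y (tpow p (x - y) * tpow q y)%:E)%E.

Lemma Gamma_egamma s : Gamma s = fine (egamma s).
Proof.
rewrite /Gamma /Rintegral /egamma integral_mkcond; congr fine.
apply: eq_integral => t _; rewrite patchE /tpow indicE.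
by case: ifPn => _; rewrite ?mul1r// !mul0r.
Qed.

(** Outside []0, x[] one of the two truncated factors has a nonpositive argument and vanishes. *)
Lemma Rintegral_econv p q x :
  \int[mu]_(y in `]0, x[) ((x - y) `^ p * y `^ q) = fine (econv p q x).
Proof.
rewrite /Rintegral /econv integral_mkcond; congr fine.
apply: eq_integral => y _; rewrite patchE mem_setE in_itv/=.
case: ifPn => [/andP[y0 yx]|yx]; first by rewrite !tpow_gt0E ?subr_gt0.
have [y0|y0] := leP y 0; first by rewrite (tpow_le0E _ _ y0) mulr0.
rewrite (tpow_le0E p (_ - _)) ?mul0r// subr_le0 leNgt.
by move: yx; rewrite y0.
Qed.

(** * Scaling of the convolution and the beta-gamma identity *)

Lemma measurable_econv_integrand p q x :
  measurable_fun [set: R] (fun y => (tpow p (x - y) * tpow q y)%:E).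
Proof.
apply/measurable_EFinP; apply: measurable_funM; last exact: measurable_tpow.
by apply: measurableT_comp; [exact: measurable_tpow|exact: measurable_funB].
Qed.

Lemma econv_le0 p q x : x <= 0 -> econv p q x = 0%E.
Proof.
move=> x0; rewrite /econv integral0_eq// => y _.
have [y0|y0] := leP y 0; first by rewrite (tpow_le0E _ _ y0) mulr0.
by rewrite (tpow_le0E p (_ - _)) ?mul0r// subr_le0 (le_trans x0)// ltW.
Qed.

(** Substituting [x * y] for [y] extracts x^p and x^q from the two factors and one more x from
    dy. *)
Lemma econv_gt0 (p q x : R) : 0 < x ->
  econv p q x = ((x `^ (p + q + 1))%:E * econv p q 1)%E.
Proof.
move=> x0; rewrite [LHS](ge0_integral_affine x 0 _ x0); last 2 first.
  exact: measurable_econv_integrand.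
  by move=> y; rewrite lee_fin mulr_ge0// tpow_ge0.
under eq_integral => y _.
  rewrite addr0 -{1}[x]mulr1 -mulrBr !tpowM// mulrACA EFinM.
  over.
rewrite ge0_integralZl//; last 3 first.
  exact: measurable_econv_integrand.
  by move=> y _; rewrite lee_fin mulr_ge0// tpow_ge0.
  by rewrite lee_fin mulr_ge0// powR_ge0.
rewrite muleA -EFinM; congr (_%:E * _)%E.
(* Side condition of [powRD], which guards the case of base 0 when the exponents sum to 0. *)
have xneq0 (r : R) : (r == 0) ==> (x != 0) by rewrite (gt_eqF x0) implybT.
rewrite (powRD (xneq0 (p + q + 1))) (powRD (xneq0 (p + q))) powRr1 ?ltW//.
by ring.
Qed.

(* Tonelli, after translating the inner variable: the Laplace transform turns the
   convolution of truncated powers into a product. *)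
Lemma egammaM p q : (egamma (p + 1) * egamma (q + 1) =
  econv p q 1 * egamma (p + q + 1 + 1))%E.
Proof.
rewrite /egamma !addrK.
have mg := measurable_gamma_integrand.
have g0 r t : (0 <= (tpow r t * expR (- t))%:E)%E.
  by rewrite lee_fin gamma_integrand_ge0.
rewrite -ge0_integralZl//; [|exact: mg|exact: integral_ge0].
(* Here [z.1] is the variable of the second gamma integral and [z.2] the sum of both variables.
   Integrating over [z.2] first gives the product, over [z.1] first the Laplace transform of the
   convolution. *)
pose F (z : measurableTypeR R * measurableTypeR R) : \bar R :=
  (tpow p (z.2 - z.1) * tpow q z.1 * expR (- z.2))%:E.
transitivity (\int[mu]_u \int[mu]_t F (u, t))%E.
  apply: eq_integral => u _; rewrite muleC -ge0_integralZl//; last exact: mg.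
  under eq_integral do rewrite -EFinM.
  rewrite [LHS](ge0_integral_affine 1 (- u) _ ltr01); last 2 first.
    apply/measurable_EFinP; apply: measurable_funM => //.
    by apply/measurable_EFinP; exact: mg.
    by move=> t; rewrite EFinM mule_ge0.
  rewrite mul1e; apply: eq_integral => t _; rewrite /F/=; congr EFin.
  have -> : expR (- t) = expR (- (t - u)) * expR (- u).
    by rewrite -expRD; congr expR; ring.
  by rewrite mul1r; ring.
rewrite [LHS](@fubini_tonelli _ _ _ _ R mu mu F); last 2 first.
  - apply/measurable_EFinP; apply: measurable_funM; last first.
      apply: measurableT_comp; first exact: measurable_expR.
      exact: measurableT_comp.
    apply: measurable_funM.
      apply: measurableT_comp; first exact: measurable_tpow.
      by apply: measurable_funB.
    by apply: measurableT_comp; first exact: measurable_tpow.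
  - by move=> z; rewrite lee_fin mulr_ge0 ?expR_ge0// mulr_ge0 ?tpow_ge0.
rewrite -ge0_integralZl//; [|exact: mg|]; last first.
  by apply: integral_ge0 => y _; rewrite lee_fin mulr_ge0 ?tpow_ge0.
apply: eq_integral => t _; rewrite /F/=.
under eq_integral do rewrite EFinM.
rewrite ge0_integralZr//; last 2 first.
  exact: measurable_econv_integrand.
  by move=> y _; rewrite lee_fin mulr_ge0 ?tpow_ge0.
(* For [t <= 0] both sides vanish; for [0 < t] scaling extracts t^(p+q+1), which together with
   e^(-t) is the remaining gamma integrand. *)
rewrite -/(econv p q t); have [t0|t0] := leP t 0.
  by rewrite econv_le0// tpow_le0E// mul0r mul0e mule0.
by rewrite econv_gt0// tpow_gt0E// EFinM [RHS]muleCA muleA.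
Qed.

(** * Finiteness and positivity of the gamma function *)

(** The integrand may blow up at 0, so the antiderivative t^s / s is used on [1/(n+1), 1], where it
    gives at most 1/s; monotone convergence passes to the union. *)
Lemma integral_powR_01 (s : R) : 0 < s ->
  (\int[mu]_(t in `]0%R, 1%R]) (t `^ (s - 1))%:E <= (s^-1)%:E)%E.
Proof.
move=> s0; have powR_ge0E t : (0 <= (t `^ (s - 1))%:E)%E.
  by rewrite lee_fin powR_ge0.
have mpow (D : set R) : measurable_fun D (fun t => (t `^ (s - 1))%:E).
  by apply/measurable_EFinP; exact: measurable_funTS.
pose F n : set R := `[0 + n.+1%:R^-1, 1]%classic.
have ndF : {homo F : n m / (n <= m)%N >-> (n <= m)%O}.
  move=> n m nm; apply/subsetPset => t; rewrite /F/= !in_itv/= => /andP[nt ->].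
  by rewrite andbT (le_trans _ nt)// !add0r lef_pV2 ?posrE// ler_nat.
rewrite itv_open_bnd_bigcup -/F.
have Fcvg : (\int[mu]_(t in F n) (t `^ (s - 1))%:E @[n --> \oo] -->
    \int[mu]_(t in \bigcup_n F n) (t `^ (s - 1))%:E)%E.
  apply: ge0_nondecreasing_set_cvg_integral => // n; last exact: mpow.
  exact: measurable_itv.
rewrite -(cvg_lim _ Fcvg)//; apply: lime_le.
  by apply/cvg_ex; eexists; exact: Fcvg.
(* For index 0 the interval is the single point 1, while the fundamental theorem needs distinct
   endpoints. *)
apply: nearW => -[|n].
  by rewrite /F add0r invr1 set_itv1 integral_set1 lee_fin invr_ge0 ltW.
set a : R := 0 + n.+2%:R^-1.
have a0 : 0 < a by rewrite /a add0r invr_gt0.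
have a1 : a < 1 by rewrite /a add0r invf_lt1// ltr1n.
have pos t : t \in `[a, 1] -> 0 < t.
  by rewrite in_itv/= => /andP[+ _]; exact: lt_le_trans.
have dF (t : R) : 0 < t ->
    is_derive t (1 : R) (fun t => s^-1 * t `^ s : R) (t `^ (s - 1)).
  move=> t0; have := is_derive1_powR s t0; move=> /(is_deriveZ s^-1).
  by rewrite /GRing.scale/= mulrA mulVf ?mul1r// gt_eqF.
have cF (t : R) : 0 < t -> {for t, continuous (fun t => s^-1 * t `^ s : R)}.
  move=> t0; apply: differentiable_continuous; apply/derivable1_diffP.
  by case: (dF t t0).
rewrite /F -/a (@continuous_FTC2 _ _ (fun t => s^-1 * t `^ s))//.
- rewrite -EFinB lee_fin powR1 mulr1 lerBlDr lerDl.
  by rewrite mulr_ge0 ?invr_ge0 ?powR_ge0// ltW.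
- apply: derivable_within_continuous => t /pos t0.
  by apply: derivable_powR; rewrite in_itv/= t0.
- split.
  + by move=> t /subset_itv_oo_cc/pos/dF[].
  + by apply: cvg_at_right_filter; exact: cF.
  + by apply: cvg_at_left_filter; exact: cF.
- move=> t /subset_itv_oo_cc/pos/dF dFt.
  by rewrite derive1E derive_val.
Qed.

(* From ln (t / (2 s)) <= t / (2 s) - 1 one gets t^s <= (2 s)^s e^(t/2). *)
Lemma tpow_expR_le (s t : R) : 0 < s -> 1 < t ->
  tpow (s - 1) t * expR (- t) <=
  2 * expR (s * ln (2 * s)) * exponential_pdf (2^-1) t.
Proof.
move=> s0 t1; have t0 : 0 < t by exact: lt_trans t1.
have s2 : 0 < 2 * s by rewrite mulr_gt0.
rewrite tpow_gt0E// /powR gt_eqF// exponential_pdfE; last exact: ltW.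
(* The constant 2 cancels the rate 1/2 in front of the exponential density; only exponents remain to
   be compared. *)
rewrite mulrACA divff// mul1r -!expRD ler_expR.
have ts : -1 < t / (2 * s) - 1 by rewrite ltrBrDl subrr divr_gt0.
have lnt : ln t <= t / (2 * s) - 1 + ln (2 * s).
  have -> : ln t = ln (1 + (t / (2 * s) - 1)) + ln (2 * s).
    by rewrite [1 + _]addrC subrK -lnM ?posrE ?divr_gt0// divfK// gt_eqF.
  by rewrite lerD2r le_ln1Dx.
(* This allows the exponent s - 1 to be raised to s. *)
have lnt0 : 0 <= ln t by rewrite ln_ge0// ltW.
have : s * ln t <= s * (t / (2 * s) - 1 + ln (2 * s)) by rewrite ler_pM2l.
have -> : s * (t / (2 * s) - 1 + ln (2 * s)) = 2^-1 * t - s + s * ln (2 * s).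
  by field; rewrite gt_eqF.
move: lnt0; lra.
Qed.

(** Up to 1 the integrand is at most t^(s-1), since e^(-t) <= 1; beyond 1 it is at most [C] times
    the exponential density of rate 1/2, whose total mass is 1. The integral is thus at most 1/s +
    C. *)
Lemma egamma_lty (s : R) : 0 < s -> (egamma s < +oo)%E.
Proof.
move=> s0; pose C := 2 * expR (s * ln (2 * s)).
pose f1 := (fun t : R => (t `^ (s - 1))%:E) \_ `]0, 1].
pose f2 t := (C%:E * (exponential_pdf (2^-1) t)%:E)%E.
have C0 : (0 <= C%:E)%E by rewrite lee_fin mulr_ge0 ?expR_ge0.
have h0 : 0 < 2^-1 :> R by rewrite invr_gt0.
have e0 t : (0 <= (exponential_pdf (2^-1 : R) t)%:E)%E.
  by rewrite lee_fin exponential_pdf_ge0// ltW.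
have me : measurable_fun [set: R] (fun t => (exponential_pdf (2^-1 : R) t)%:E).
  by apply/measurable_EFinP; exact: measurable_exponential_pdf.
have f10 t : (0 <= f1 t)%E.
  by apply: erestrict_ge0 => y _; rewrite lee_fin powR_ge0.
have f20 t : (0 <= f2 t)%E by rewrite mule_ge0.
have mf1 : measurable_fun [set: R] f1.
  apply/(measurable_restrictT _ _).1 => //.
  by apply/measurable_EFinP; exact: measurable_funTS.
have mf2 : measurable_fun [set: R] f2 by exact: measurable_funeM.
apply: (@le_lt_trans _ _ (\int[mu]_t (f1 t + f2 t))%E).
  apply: ge0_le_integral => //.
  - by move=> t _; rewrite lee_fin gamma_integrand_ge0.
  - exact: measurable_gamma_integrand.
  - exact: emeasurable_funD.
  move=> t _; have [t0|t0] := leP t 0.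
    by rewrite tpow_le0E// mul0r adde_ge0.
  have [t1|t1] := leP t 1.
    rewrite -[leLHS]adde0 leeD// /f1 patchE mem_setE in_itv/= t0 t1.
    rewrite tpow_gt0E// lee_fin ler_piMr ?powR_ge0//.
    by rewrite -expR0 ler_expR oppr_le0 ltW.
  by rewrite -[leLHS]add0e leeD// /f2 -EFinM lee_fin tpow_expR_le.
rewrite ge0_integralD//.
rewrite /f1 -integral_mkcond /f2 ge0_integralZl// integral_exponential_pdf//.
rewrite mule1 lte_add_pinfty ?ltry//.
exact: le_lt_trans (integral_powR_01 _ s0) (ltry _).
Qed.

(** On [1, 2] the integrand is at least e^(-3): there ln t >= 0 and ln t <= t - 1, so (s - 1) ln t -
    t >= 1 - 2t >= -3. *)
Lemma egamma_gt0 (s : R) : 0 < s -> (0 < egamma s)%E.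
Proof.
move=> s0.
apply: (@lt_le_trans _ _ (\int[mu]_(t in `[1%R, 2%R]) (expR (- 3))%:E)%E).
  rewrite integral_cst//= lebesgue_measure_itv/= lte_fin ltr1n/=.
  by rewrite -EFinB -EFinM lte_fin mulr_gt0 ?expR_gt0//; lra.
apply: (@le_trans _ _ (\int[mu]_(t in `[1%R, 2%R])
    (tpow (s - 1) t * expR (- t))%:E)%E).
  apply: ge0_le_integral => //.
    by apply: measurable_funTS; exact: measurable_gamma_integrand.
  move=> t; rewrite /= in_itv/= => /andP[t1 t2].
  have t0 : 0 < t by exact: lt_le_trans t1.
  rewrite lee_fin tpow_gt0E// /powR gt_eqF// -expRD ler_expR.
  have lnt : ln t <= t - 1.
    have tE : t = 1 + (t - 1) by rewrite addrC subrK.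
    by rewrite {1}tE le_ln1Dx// ltrBrDl subrr.
  have : 0 <= s * ln t by rewrite mulr_ge0 ?ln_ge0// ltW.
  lra.
apply: ge0_subset_integral => //; first exact: measurable_gamma_integrand.
by move=> t _; rewrite lee_fin gamma_integrand_ge0.
Qed.

Lemma Gamma_gt0 (s : R) : 0 < s -> 0 < Gamma s.
Proof.
by move=> s0; rewrite Gamma_egamma fine_gt0// egamma_gt0// egamma_lty.
Qed.

Lemma egammaE (s : R) : 0 < s -> egamma s = (Gamma s)%:E.
Proof.
move=> s0; rewrite Gamma_egamma fineK// ge0_fin_numE ?egamma_lty//.
exact/ltW/egamma_gt0.
Qed.

(** * Closed form of the fractional integral of a power, and the ratio *)

Lemma fracint_powR (s k x : R) : 0 < s -> 0 < k -> 0 < x ->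
  fracint s (fun y => y `^ k) x =
  Gamma (k + 1) / Gamma (s + k + 1) * x `^ (s + k).
Proof.
move=> s0 k0 x0; have k10 : 0 < k + 1 by rewrite addr_gt0.
have sk10 : 0 < s + k + 1 by rewrite !addr_gt0.
rewrite /fracint Rintegral_econv econv_gt0//.
have skE : s - 1 + k + 1 = s + k by ring.
have := egammaM (s - 1) k; rewrite skE subrK !egammaE// => GE.
(* The gamma values being finite and positive, the beta-gamma identity can be solved for the beta
   value. *)
have -> : econv (s - 1) k 1 = (Gamma s * Gamma (k + 1) / Gamma (s + k + 1))%:E.
  by rewrite !EFinM GE -muleA -EFinM mulfV ?mule1// gt_eqF// Gamma_gt0.
by rewrite -EFinM/=; field; rewrite !gt_eqF ?Gamma_gt0.
Qed.

End beta_gamma.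

Theorem mainTheorem6 (R : realType) :
  (forall s k : R, 0 < s -> 0 < k ->
     (forall x : R, 0 < x ->
        fracint s (fun y => y `^ k) x / fracint k (fun y => y `^ s) x
        = Gamma (k + 1) / Gamma (s + 1)) /\
     (forall x x' : R, 0 < x -> 0 < x' ->
        fracint s (fun y => y `^ k) x / fracint k (fun y => y `^ s) x
        = fracint s (fun y => y `^ k) x' / fracint k (fun y => y `^ s) x')) /\
  (let e : R := expR 1 in
   forall x : R, 0 < x ->
     [/\ fracint pi (fun y => y `^ e) x
           = Gamma (e + 1) / Gamma (e + pi + 1) * x `^ (pi + e),
         fracint e (fun y => y `^ pi) x
           = Gamma (pi + 1) / Gamma (e + pi + 1) * x `^ (pi + e) &
         fracint pi (fun y => y `^ e) x / fracint e (fun y => y `^ pi) x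
           = Gamma (e + 1) / Gamma (pi + 1)]).
Proof.
have ratio (s k x : R) : 0 < s -> 0 < k -> 0 < x ->
    fracint s (fun y => y `^ k) x / fracint k (fun y => y `^ s) x
    = Gamma (k + 1) / Gamma (s + 1).
  (* After [k + s] is commuted, both closed forms share Gamma(s+k+1) and x^(s+k), which are nonzero
     and cancel. *)
  move=> s0 k0 x0; rewrite !fracint_powR// (addrC k s).
  have G0 (r : R) : 0 < r -> Gamma (r + 1) != 0.
    by move=> r0; rewrite gt_eqF// Gamma_gt0// addr_gt0.
  by field; rewrite !G0 ?addr_gt0//= gt_eqF// powR_gt0.
split=> [s k s0 k0|e x x0].
  split=> [x x0|x x' x0 x'0]; first exact: ratio.
  by rewrite (ratio s k x) ?(ratio s k x').
have e0 : 0 < e by exact: expR_gt0.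
have pi0 := @pi_gt0 R.
by split; [| |exact: ratio]; rewrite fracint_powR// (addrC e pi).
Qed.
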